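(* Let $k\ge 3$ be an integer and let $G$ be a connected $k$-regular graph of order $n$ that is not isomorphic to $K_{k+1}$. If $G$ has a triangle, then $\gamma_{\rm gr}^{\rm Z}(G)\ge \frac{n-1}{k-1}$. If $G$ is triangle-free, then $\gamma_{\rm gr}^{\rm Z}(G)\ge\frac{n-2}{k-1}$.
   Context: Graphs are finite and simple; the order of a graph is its number of vertices. $N_G(v)$ is the set of neighbors of $v$ and $N_G[v]=N_G(v)\cup\{v\}$. For a graph $G$ with no isolated vertices, a sequence $(v_1,\ldots,v_m)$ of vertices of $G$ is a Z-sequence if it consists of distinct vertices and for every $i\in\{2,\ldots,m\}$, $N_G(v_i)\setminus\bigcup_{j=1}^{i-1}N_G[v_j]\neq\emptyset$. The Z-Grundy domination number $\gamma_{\rm gr}^{\rm Z}(G)$ is the maximum length of a Z-sequence in $G$. *)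

(* Defs.v *)
From mathcomp Require Import all_boot all_order all_algebra.

Set Implicit Arguments.
Unset Strict Implicit.
Unset Printing Implicit Defensive.

Record sgraph := SGraph {
  vertex :> finType;
  adj : rel vertex;
  adj_sym : symmetric adj;
  adj_irrefl : irreflexive adj
}.

Definition open_nbhd (G : sgraph) (v : G) : {set G} := [set u | adj v u].

Definition closed_nbhd (G : sgraph) (v : G) : {set G} := v |: open_nbhd v.

Definition regular (G : sgraph) (k : nat) : Prop :=
  forall v : G, #|open_nbhd v| = k.

Definition connected_graph (G : sgraph) : Prop :=
  0 < #|G| /\ forall x y : G, connect (@adj G) x y.

Definition graph_isomorphic (G H : sgraph) : Prop :=
  exists2 f : G -> H, bijective f & forall x y : G, adj (f x) (f y) = adj x y.

Lemma complete_adj_sym (n : nat) : symmetric (fun i j : 'I_n => i != j).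
Proof. by move=> i j; rewrite eq_sym. Qed.

Lemma complete_adj_irrefl (n : nat) : irreflexive (fun i j : 'I_n => i != j).
Proof. by move=> i; rewrite eqxx. Qed.

Definition complete_graph (n : nat) : sgraph :=
  SGraph (@complete_adj_sym n) (@complete_adj_irrefl n).

(* The three vertices are distinct because adj is irreflexive. *)
Definition has_triangle (G : sgraph) : Prop :=
  exists x y z : G, [/\ adj x y, adj y z & adj z x].

Definition triangle_free (G : sgraph) : Prop := ~ has_triangle G.

(* Positions are numbered from 0, so the condition on v_2, ..., v_m is the
   one on positions i with 0 < i. *)
Definition z_sequence (G : sgraph) (m : nat) (s : m.-tuple G) : bool :=
  uniq s &&
  [forall i : 'I_m, (0 < i) ==>
     (open_nbhd (tnth s i) :\:
        \bigcup_(j < m | j < i) closed_nbhd (tnth s j) != set0)].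

(* Bounding m by #|G| loses nothing, as the entries are distinct:
   see leq_z_grundy and z_grundy_attained. *)
Definition z_grundy (G : sgraph) : nat :=
  \max_(m < #|G|.+1 | [exists s : m.-tuple G, z_sequence s]) m.

Lemma leq_z_grundy (G : sgraph) (m : nat) (s : m.-tuple G) :
  z_sequence s -> m <= z_grundy G.
Proof.
move=> zs; have [us _] := andP zs.
have lt_m : m < #|G|.+1.
  by rewrite ltnS -(size_tuple s) -(card_uniqP us) max_card.
rewrite /z_grundy (bigD1 (Ordinal lt_m)) /=; first exact: leq_maxl.
by apply/existsP; exists s.
Qed.

Lemma z_grundy_attained (G : sgraph) :
  exists s : (z_grundy G).-tuple G, z_sequence s.
Proof.
rewrite /z_grundy; elim/big_rec: _ => [|m p /existsP zm zp].
  by exists [tuple]; apply/andP; split=> //; apply/forallP => -[].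
by rewrite /maxn; case: ifP.
Qed.

(* Main.v *)
Require Import Defs.
From mathcomp Require Import all_boot all_order all_algebra.

(** Build a Z-sequence greedily and follow the set of dominated vertices, the
    union of the closed neighborhoods of its entries.  While some vertex is
    undominated, connectedness gives an edge from a dominated vertex [w] to an
    undominated one.  All neighbors of an entry are dominated, so [w] is not an
    entry; it can be appended, and as [w] itself and an entry adjacent to it are
    already dominated, at most [k - 1] vertices become dominated
    ([z_sequence_extend]).  Hence a Z-sequence of length [m > 0] that dominates
    at most [m (k - 1) + c] vertices grows to a dominating one with the same
    [c], and [n <= gamma (k - 1) + c], where [gamma] is the Z-Grundy domination
    number ([order_le_z_grundy]).

    A single vertex dominates [k + 1 = (k - 1) + 2] vertices, so [c = 2] is
    always possible.  A triangle saves one more.  If [a], [b], [c] form a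
    triangle and [b] has a neighbor outside [N[a]], then [(a, b)] is a
    Z-sequence in which [b] newly dominates at most [k - 2] vertices, because
    [a], [b] and [c] all lie in [N[a]]; this gives [c = 1].  Such a triangle
    exists in every connected graph with a triangle unless a vertex is adjacent
    to all others ([triangle_with_escaping_edge]), and a regular graph with such
    a vertex is complete ([regular_universal_complete]). *)

Set Implicit Arguments.
Unset Strict Implicit.
Unset Printing Implicit Defensive.

Import GRing.Theory Num.Theory.

Definition dominated (G : sgraph) (s : seq G) : {set G} :=
  \bigcup_(v in s) closed_nbhd v.

Lemma in_closed_nbhd (G : sgraph) (u v : G) :
  (u \in closed_nbhd v) = (u == v) || adj v u.
Proof. by rewrite !inE. Qed.

Lemma dominatedP (G : sgraph) (s : seq G) (u : G) :
  reflect (exists2 v, v \in s & u \in closed_nbhd v) (u \in dominated s).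
Proof. exact: bigcupP. Qed.

Lemma dominated_rcons (G : sgraph) (s : seq G) (v : G) :
  dominated (rcons s v) = dominated s :|: closed_nbhd v.
Proof.
apply/setP => u; rewrite in_setU; apply/dominatedP/orP.
  case=> w; rewrite mem_rcons inE => /orP[/eqP-> | ws] uw; first by right.
  by left; apply/dominatedP; exists w.
case=> [/dominatedP[w ws uw] | uv].
  by exists w; rewrite // mem_rcons inE ws orbT.
by exists v; rewrite // mem_rcons mem_head.
Qed.

Lemma dominated1 (G : sgraph) (v : G) : dominated [:: v] = closed_nbhd v.
Proof.
rewrite -[[:: v]]/(rcons [::] v) dominated_rcons.
by rewrite /dominated big_pred0 ?set0U // => w; rewrite inE.
Qed.

Lemma card_closed_nbhd (G : sgraph) (v : G) :
  #|closed_nbhd v| = #|open_nbhd v|.+1.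
Proof. by rewrite cardsU1 inE adj_irrefl. Qed.

(** A dominated [v] can only newly dominate neighbors, so every dominated
    neighbor of [v] is one vertex less. *)
Lemma card_dominated_rcons (G : sgraph) (s : seq G) (v : G) :
  v \in dominated s ->
  #|dominated (rcons s v)| + #|open_nbhd v :&: dominated s| =
  #|dominated s| + #|open_nbhd v|.
Proof.
move=> vD; rewrite dominated_rcons.
have ->: dominated s :|: closed_nbhd v = dominated s :|: open_nbhd v.
  by rewrite setUCA; apply/setUidPr; rewrite sub1set inE vD.
by rewrite [_ :&: dominated s]setIC cardsUI.
Qed.

Lemma z_sequence1 (G : sgraph) (v : G) : z_sequence [tuple v].
Proof. by apply/andP; split=> //; apply/forallP => -[[]]. Qed.

Lemma z_sequence_rcons (G : sgraph) (m : nat) (s : m.-tuple G) (v : G) :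
  z_sequence s -> open_nbhd v :\: dominated s != set0 ->
  z_sequence (rcons_tuple s v).
Proof.
move=> /andP[us /forallP zs] /set0Pn[u /setDP[vu uD]].
apply/andP; split.
  rewrite rcons_uniq us andbT; apply: contra uD => vs.
  by apply/dominatedP; exists v; rewrite // inE vu orbT.
have tnth_old (i : 'I_m.+1) (lt_im : i < m) :
    tnth (rcons_tuple s v) i = tnth s (Ordinal lt_im).
  by rewrite !(tnth_nth v) nth_rcons size_tuple lt_im.
apply/forallP => i; apply/implyP => i_gt0.
have [lt_im | le_mi] := ltnP i m.
  have /set0Pn[x /setDP[ix xU]] := implyP (zs (Ordinal lt_im)) i_gt0.
  apply/set0Pn; exists x; rewrite in_setD tnth_old ix andbT.
  apply: contra xU => /bigcupP[j lt_ji].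
  have lt_jm := ltn_trans lt_ji lt_im.
  by rewrite tnth_old => xj; apply/bigcupP; exists (Ordinal lt_jm).
have i_m : i = m :> nat by apply/eqP; rewrite eqn_leq le_mi -ltnS ltn_ord.
have ->: tnth (rcons_tuple s v) i = v.
  by rewrite (tnth_nth v) nth_rcons size_tuple i_m ltnn eqxx.
apply/set0Pn; exists u; rewrite in_setD vu andbT.
apply: contra uD => /bigcupP[j]; rewrite i_m => lt_jm.
rewrite tnth_old => uj; apply/dominatedP.
by exists (tnth s (Ordinal lt_jm)); first exact: mem_tnth.
Qed.

Lemma connected_frontier (G : sgraph) (A : {set G}) :
  connected_graph G -> A != set0 -> A != setT ->
  exists w u, [/\ w \in A, u \notin A & adj w u].
Proof.
move=> [_ conn] /set0Pn[x xA] AnT.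
have [y yA]: exists y, y \notin A.
  apply/existsP; rewrite -negb_forall; apply: contra AnT => /forallP AT.
  by apply/eqP/setP => y; rewrite AT inE.
have [/existsP[w /existsP[u /and3P[]]] | none] :=
  boolP [exists w, exists u, [&& w \in A, u \notin A & adj w u]].
  by exists w, u.
have stay w u : adj w u -> w \in A -> u \in A.
  move=> wu wA; apply: contraR none => uA.
  by apply/existsP; exists w; apply/existsP; exists u; rewrite wA uA.
have clA : closed (@adj G) A.
  by move=> w u wu; apply/idP/idP; apply: stay => //; rewrite adj_sym.
by case/negP: yA; rewrite -(closed_connect clA (conn x y)).
Qed.

(** The appended vertex is the dominated end of an edge leaving the dominated
    set.  Not being an entry, it has an entry among its dominated neighbors. *)
Lemma z_sequence_extend (G : sgraph) (k m : nat) (s : m.-tuple G) :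
  connected_graph G -> regular G k -> z_sequence s -> 0 < m ->
  dominated s != setT ->
  exists2 t : m.+1.-tuple G, z_sequence t & #|dominated t| < #|dominated s| + k.
Proof.
move=> conn reg zs m_gt0 DnT.
have D_n0 : dominated s != set0.
  pose v := tnth s (Ordinal m_gt0).
  apply/set0Pn; exists v; apply/dominatedP; exists v; first exact: mem_tnth.
  by rewrite in_closed_nbhd eqxx.
have [w [u [wD uD wu]]] := connected_frontier conn D_n0 DnT.
exists (rcons_tuple s w).
  by apply: z_sequence_rcons => //; apply/set0Pn; exists u; rewrite !inE uD.
rewrite -(reg w) -(card_dominated_rcons wD) -[ltnLHS]addn0 ltn_add2l card_gt0.
have /dominatedP[v vs] := wD; rewrite in_closed_nbhd => /orP[/eqP wv | vw].
  case/negP: uD; apply/dominatedP; exists v => //.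
  by rewrite in_closed_nbhd -wv wu orbT.
apply/set0Pn; exists v; rewrite !inE adj_sym vw /=.
by apply/dominatedP; exists v; rewrite // in_closed_nbhd eqxx.
Qed.

Lemma order_le_z_grundy (G : sgraph) (k c m : nat) (s : m.-tuple G) :
  connected_graph G -> regular G k -> 0 < k -> z_sequence s -> 0 < m ->
  #|dominated s| <= m * k.-1 + c -> #|G| <= z_grundy G * k.-1 + c.
Proof.
move=> conn reg k_gt0.
(* Appending shortens the distance from [m] to its upper bound. *)
have [d] := ubnP (z_grundy G - m); elim: d m s => // d IHd m s lt_d zs m_gt0 leD.
have [DT | DnT] := eqVneq (dominated s) setT.
  have le_m := leq_z_grundy zs.
  by rewrite -cardsT -DT (leq_trans leD) // leq_add2r leq_mul2r le_m orbT.
have [t zt ltD] := z_sequence_extend conn reg zs m_gt0 DnT.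
apply: (IHd _ t) => //.
  by rewrite -ltnS (leq_trans _ lt_d) // ltnS ltn_sub2l // (leq_z_grundy zt).
rewrite -ltnS (leq_trans ltD) // mulSn -!addSn prednK //.
by rewrite addnC -addnA leq_add2l.
Qed.

(** An edge from [w] in [N[x]] to the outside, where [x], [y], [z] is a
    triangle, yields the result in each case: with [x], [y], [z] if [w] is [y],
    with [x], [w], [y] if [w] is adjacent to [y], and with [y], [x], [z]
    otherwise, [w] then being the neighbor of [x] outside [N[y]]. *)
Lemma triangle_with_escaping_edge (G : sgraph) :
  connected_graph G -> has_triangle G ->
  (exists x : G, closed_nbhd x = setT) \/
  (exists a b c : G, [/\ adj a b, adj b c, adj c a
     & open_nbhd b :\: closed_nbhd a != set0]).
Proof.
move=> conn [x [y [z [xy yz zx]]]].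
have [NT | NnT] := eqVneq (closed_nbhd x) setT; first by left; exists x.
right.
have N_n0 : closed_nbhd x != set0.
  by apply/set0Pn; exists x; rewrite in_closed_nbhd eqxx.
have [w [u [wx ux wu]]] := connected_frontier conn N_n0 NnT.
have {wx} xw : adj x w.
  move: wx; rewrite in_closed_nbhd => /orP[/eqP wx | //].
  by move: ux; rewrite in_closed_nbhd -wx wu orbT.
have escape : open_nbhd w :\: closed_nbhd x != set0.
  by apply/set0Pn; exists u; rewrite in_setD ux inE.
have [wy | wny] := eqVneq w y.
  by exists x, y, z; rewrite -[in open_nbhd _]wy.
have [yw | ynw] := boolP (adj y w).
  by exists x, w, y; split; rewrite // adj_sym.
exists y, x, z; split; rewrite 1?adj_sym //.
by apply/set0Pn; exists w; rewrite in_setD in_closed_nbhd negb_or wny ynw inE.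
Qed.

(** The closed neighborhoods all have the same size, so they all equal the
    vertex set as soon as one does. *)
Lemma regular_universal_complete (G : sgraph) (k : nat) (x : G) :
  regular G k -> closed_nbhd x = setT -> graph_isomorphic G (complete_graph k.+1).
Proof.
move=> reg NT.
have card_G : #|G| = k.+1 by rewrite -cardsT -NT card_closed_nbhd reg.
have adjE (u v : G) : adj u v = (u != v).
  have [-> | unv] := eqVneq u v; first by rewrite adj_irrefl.
  have NuT : closed_nbhd u = setT.
    by apply/eqP; rewrite eqEcard subsetT cardsT card_closed_nbhd reg card_G /=.
  by have := in_setT v; rewrite -NuT in_closed_nbhd eq_sym (negPf unv).
pose f (u : G) : complete_graph k.+1 := cast_ord card_G (enum_rank u).
have inj_f : injective f by move=> u v /cast_ord_inj/enum_rank_inj.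
exists f; last by move=> u v; rewrite adjE /= (inj_eq inj_f).
by apply: (inj_card_bij inj_f); rewrite /= card_ord card_G.
Qed.

Lemma order_le_z_grundy_add2 (G : sgraph) (k : nat) :
  connected_graph G -> regular G k -> 0 < k -> #|G| <= z_grundy G * k.-1 + 2.
Proof.
move=> conn reg k_gt0.
have /card_gt0P[v _] := conn.1.
apply: (order_le_z_grundy conn reg k_gt0 (z_sequence1 v)) => //.
by rewrite dominated1 card_closed_nbhd reg mul1n addn2 prednK.
Qed.

Lemma order_le_z_grundy_add1 (G : sgraph) (k : nat) :
  connected_graph G -> regular G k -> 0 < k -> has_triangle G ->
  ~ graph_isomorphic G (complete_graph k.+1) -> #|G| <= z_grundy G * k.-1 + 1.
Proof.
move=> conn reg k_gt0 tri nK.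
have [[x NT] | [a [b [c [ab bc ca esc]]]]] := triangle_with_escaping_edge conn tri.
  by case: nK; apply: regular_universal_complete NT.
have zab : z_sequence (rcons_tuple [tuple a] b).
  by apply: z_sequence_rcons; rewrite ?z_sequence1 // dominated1.
apply: (order_le_z_grundy conn reg k_gt0 zab) => //.
have bD : b \in dominated [:: a] by rewrite dominated1 in_closed_nbhd ab orbT.
have := card_dominated_rcons bD; rewrite dominated1 card_closed_nbhd !reg /=.
(* Both [a] and [c] are neighbors of [b] in [N[a]]. *)
have: 2 <= #|open_nbhd b :&: closed_nbhd a|.
  have <- : #|[set a; c]| = 2.
    by rewrite cards2; have [ac | //] := eqVneq a c; rewrite ac adj_irrefl in ca.
  apply/subset_leq_card/subsetP => u /set2P[]->;
    by rewrite !inE ?eqxx ?bc 1?adj_sym ?ab ?ca ?orbT.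
move=> ge2 eqD; rewrite -(leq_add2r 2); apply: leq_trans (_ : k.+1 + k <= _).
  by rewrite -eqD leq_add2l.
by rewrite -[in leqLHS](prednK k_gt0) mul2n -addnn !addnS !addSn !addn0.
Qed.

Theorem theorem3p1 (k n : nat) (G : sgraph) :
  3 <= k -> connected_graph G -> regular G k -> #|G| = n ->
  ~ graph_isomorphic G (complete_graph k.+1) ->
  (has_triangle G ->
     ((n%:R - 1) / (k%:R - 1) <= (z_grundy G)%:R :> rat)%R) /\
  (triangle_free G ->
     ((n%:R - 2) / (k%:R - 1) <= (z_grundy G)%:R :> rat)%R).
Proof.
move=> k_ge3 conn reg card_G nK.
have k_gt0 : 0 < k by apply: leq_trans k_ge3.
have to_rat c : #|G| <= z_grundy G * k.-1 + c ->
    ((n%:R - c%:R) / (k%:R - 1) <= (z_grundy G)%:R :> rat)%R.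
  move=> le_n; rewrite -(natrB _ k_gt0) subn1.
  rewrite ler_pdivrMr; last first.
    by rewrite ltr0n -ltnS prednK ?(ltnW k_ge3).
  by rewrite lerBlDr -natrM -natrD ler_nat -card_G.
split=> [tri | _].
  exact: to_rat 1 (order_le_z_grundy_add1 conn reg k_gt0 tri nK).
exact: to_rat 2 (order_le_z_grundy_add2 conn reg k_gt0).
Qed.
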